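(* For each integer $m\geq 1$ and each $\lambda\in\mathbb{C}$ with $|\lambda+1|>\sqrt{m+1}$, the polynomial $p_{m,\lambda}(z)=z^{m}+\cdots+z-\lambda$ (that is, $p_{m,\lambda}(z)=\sum_{j=1}^m z^j-\lambda$) is a cyclic vector for $\mathcal{W}=(W_n)_{n\ge 1}$.
   Context: $H^2$ is the Hardy–Hilbert space of analytic functions $f(z)=\sum_{k\ge 0}\hat f(k)z^k$ on the open unit disk with square-summable coefficients and inner product $\langle f,g\rangle=\sum_{k\ge0}\hat f(k)\overline{\hat g(k)}$. For $n\ge 1$, $W_n$ is the bounded operator on $H^2$ given by $W_nf(z)=(1+z+\cdots+z^{n-1})f(z^n)$. A vector $f\in H^2$ is a cyclic vector for $\mathcal{W}=(W_n)_{n\ge1}$ if $\mathrm{span}\{W_nf:n\ge 1\}$ is dense in $H^2$. *)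

(* Defs.v *)
From Stdlib Require Import Reals ClassicalEpsilon.
From Coquelicot Require Import Coquelicot.
Open Scope C_scope.

(* Functions on the open unit disk are represented by total functions C -> C;
   no definition below looks at values outside the disk. *)

Definition has_expansion (f : C -> C) (a : nat -> C) : Prop :=
  forall z : C, (Cmod z < 1)%R ->
    is_pseries (K := C_AbsRing) (V := C_NormedModule) a z (f z).

Definition in_H2 (f : C -> C) : Prop :=
  exists a : nat -> C,
    has_expansion f a /\ ex_series (fun k => (Cmod (a k) ^ 2)%R).

(* The sequence of Taylor coefficients at 0: the unique [a] such that
   [has_expansion f a], an arbitrary sequence if f is not analytic on the
   disk. *)
Definition hat (f : C -> C) : nat -> C :=
  epsilon (inhabits (fun _ : nat => RtoC 0)) (has_expansion f).

(* [Series] is real-valued, so the sum is taken componentwise. *)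
Definition H2_inner (f g : C -> C) : C :=
  (Series (fun k => Re (hat f k * Cconj (hat g k))),
   Series (fun k => Im (hat f k * Cconj (hat g k)))).

Definition H2_norm (f : C -> C) : R := sqrt (Re (H2_inner f f)).

Definition H2_dense (S : (C -> C) -> Prop) : Prop :=
  forall (g : C -> C) (eps : R), in_H2 g -> (0 < eps)%R ->
    exists h : C -> C,
      S h /\ in_H2 h /\ (H2_norm (fun z => (g z - h z)%C) < eps)%R.

(* Intended for n >= 1 only. *)
Definition W (n : nat) (f : C -> C) : C -> C :=
  fun z => sum_n_m (fun j => z ^ j) 0 (n - 1) * f (z ^ n).

Definition W_span (f h : C -> C) : Prop :=
  exists (N : nat) (c : nat -> C),
    forall z : C, (Cmod z < 1)%R ->
      h z = sum_n_m (fun n => c n * W n f z) 1 N.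

Definition W_cyclic (f : C -> C) : Prop :=
  in_H2 f /\ H2_dense (W_span f).

Definition p (m : nat) (lambda : C) : C -> C :=
  fun z => sum_n_m (fun j => z ^ j) 1 m - lambda.

(* Main.v *)
(* With [q = m + 1], [p m lambda = (W_q - (lambda + 1)) 1]. As [W_n W_q = W_(nq)]
   and [W_q] is [sqrt q] times an isometry, the hypothesis makes
   [W_q - (lambda + 1)] invertible, by a Neumann series in the powers of [W_q].
   Hence each [W_n 1 = 1 + z + ... + z^(n-1)] is a limit of combinations of the
   [W_(n q^k) (p m lambda)], and the [W_n 1] span the polynomials. *)

Require Import Defs.
From Stdlib Require Import Reals ClassicalEpsilon Lra Lia.
From Coquelicot Require Import Coquelicot.

(** * Finite sums, and complex series taken componentwise *)

Lemma is_series_finite {K : AbsRing} {V : NormedModule K} (a : nat -> V)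
  (N : nat) :
  (forall k, (N < k)%nat -> a k = zero) -> is_series a (sum_n a N).
Proof.
intros a0.
apply (filterlim_ext_loc (fun _ => sum_n a N)).
- exists N; intros n Nn; unfold sum_n.
  destruct (Nat.eq_dec n N) as [->|nN]; [easy|].
  rewrite (sum_n_m_Chasles a 0 N n) by lia.
  rewrite (sum_n_m_ext_loc a (fun _ => zero) (S N) n).
  + now rewrite sum_n_m_const_zero, plus_zero_r.
  + intros k Hk; apply a0; lia.
- apply filterlim_const.
Qed.

Lemma pow_n_Cpow (z : C) (n : nat) : pow_n (K := C_AbsRing) z n = (z ^ n)%C.
Proof. induction n as [|n IH]; simpl; [easy|now rewrite IH]. Qed.

Lemma sum_n_Re (u : nat -> C) (n : nat) :
  Re (sum_n (G := C_AbelianMonoid) u n) = sum_n (fun k => Re (u k)) n.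
Proof.
induction n as [|n IH]; [now rewrite !sum_O|].
now rewrite !sum_Sn, <- IH.
Qed.

Lemma sum_n_Im (u : nat -> C) (n : nat) :
  Im (sum_n (G := C_AbelianMonoid) u n) = sum_n (fun k => Im (u k)) n.
Proof.
induction n as [|n IH]; [now rewrite !sum_O|].
now rewrite !sum_Sn, <- IH.
Qed.

(** Balls of [C] are products of real balls, so the preimage under [Re] of a neighbourhood of [Re l]
    is a neighbourhood of [l]. *)
Lemma is_series_Re (u : nat -> C) (l : C) :
  is_series (K := C_AbsRing) (V := C_NormedModule) u l ->
  is_series (fun k => Re (u k)) (Re l).
Proof.
intros ul P [e Pe]; specialize (ul (fun y => P (Re y))).
destruct ul as [N HN].
- exists e; intros y [yRe _]; now apply Pe.
- exists N; intros n Nn; rewrite <- sum_n_Re; now apply HN.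
Qed.

Lemma is_series_Im (u : nat -> C) (l : C) :
  is_series (K := C_AbsRing) (V := C_NormedModule) u l ->
  is_series (fun k => Im (u k)) (Im l).
Proof.
intros ul P [e Pe]; specialize (ul (fun y => P (Im y))).
destruct ul as [N HN].
- exists e; intros y [_ yIm]; now apply Pe.
- exists N; intros n Nn; rewrite <- sum_n_Im; now apply HN.
Qed.

(** * Uniqueness of Taylor coefficients *)

(** Convergence at [1 / 2] makes both radii of convergence positive, and power series whose sums
    agree near 0 have the same coefficients. *)
Lemma PSeries_coef_unique (a b : nat -> R) (f : R -> R) :
  (forall x, Rabs x < 1 -> is_pseries a x (f x)) ->
  (forall x, Rabs x < 1 -> is_pseries b x (f x)) ->
  forall k, a k = b k.
Proof.
assert (radius : forall c, (forall x, Rabs x < 1 -> is_pseries c x (f x)) ->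
  Rbar_lt 0 (CV_radius c)).
{ intros c Hc.
  assert (half : Rabs (1 / 2) < 1) by (rewrite Rabs_pos_eq; lra).
  apply Rbar_lt_le_trans with (Rabs (1 / 2)).
  - simpl; rewrite Rabs_pos_eq; lra.
  (* Beyond the radius of convergence the terms would not tend to 0, but at [1 / 2] they do. *)
  - apply Rbar_not_lt_le; intros Hlt; apply (CV_disk_outside _ _ Hlt).
    apply ex_series_lim_0; exists (f (1 / 2)%R).
    now apply is_pseries_R, Hc. }
intros Ha Hb k; apply PSeries_ext_recip; [now apply radius..|].
exists (mkposreal 1 Rlt_0_1); intros x Hx.
assert (x1 : Rabs x < 1).
(* The ball condition around 0 unfolds to [Rabs (x + - 0) < 1]. *)
{ revert Hx; cbv -[Rabs Rlt Rplus Ropp IZR]; now rewrite Ropp_0, Rplus_0_r. }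
now rewrite (is_pseries_unique _ _ _ (Ha x x1)), (is_pseries_unique _ _ _ (Hb x x1)).
Qed.

(** Restricting to the real diameter and taking real and imaginary parts gives real power series
    with coefficients [Re (a k)] and [Im (a k)], where uniqueness is known. *)
Lemma has_expansion_unique (f : C -> C) (a b : nat -> C) :
  has_expansion f a -> has_expansion f b -> forall k, a k = b k.
Proof.
assert (real : forall c, has_expansion f c -> forall x, Rabs x < 1 ->
  is_pseries (fun k => Re (c k)) x (Re (f x)) /\
  is_pseries (fun k => Im (c k)) x (Im (f x))).
{ intros c Hc x x1.
  assert (Hx := Hc (RtoC x)); rewrite Cmod_R in Hx; specialize (Hx x1).
  split; apply is_pseries_R.
  - eapply is_series_ext; [|apply (is_series_Re _ _ Hx)].
    intros k; change (Re (pow_n (K := C_AbsRing) (RtoC x) k * c k)%C =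
      Re (c k) * x ^ k)%R.
    rewrite pow_n_Cpow, <- RtoC_pow; unfold Re, Im; simpl; ring.
  - eapply is_series_ext; [|apply (is_series_Im _ _ Hx)].
    intros k; change (Im (pow_n (K := C_AbsRing) (RtoC x) k * c k)%C =
      Im (c k) * x ^ k)%R.
    rewrite pow_n_Cpow, <- RtoC_pow; unfold Re, Im; simpl; ring. }
intros Ha Hb k; apply injective_projections.
- apply (PSeries_coef_unique (fun k => Re (a k)) (fun k => Re (b k))
    (fun x => Re (f x))); intros x x1; now apply real.
- apply (PSeries_coef_unique (fun k => Im (a k)) (fun k => Im (b k))
    (fun x => Im (f x))); intros x x1; now apply real.
Qed.

(** Lets any explicit expansion replace the sequence chosen by [epsilon]. *)
Lemma hat_eq (f : C -> C) (a : nat -> C) :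
  has_expansion f a -> forall k, hat f k = a k.
Proof.
intros fa; apply (has_expansion_unique f); [|easy].
unfold hat; apply (epsilon_spec _ (has_expansion f)); now exists a.
Qed.

(** * Linear operations on expansions; polynomials *)

Lemma has_expansion_ext (f g : C -> C) (a b : nat -> C) :
  (forall z, (Cmod z < 1)%R -> f z = g z) -> (forall k, a k = b k) ->
  has_expansion f a -> has_expansion g b.
Proof.
intros fg ab fa z z1; rewrite <- fg by easy.
apply (is_series_ext (V := C_NormedModule)) with (2 := fa z z1).
intros k; now rewrite ab.
Qed.

Lemma has_expansion_plus (f g : C -> C) (a b : nat -> C) :
  has_expansion f a -> has_expansion g b ->
  has_expansion (fun z => f z + g z)%C (fun k => a k + b k)%C.
Proof. intros fa gb z z1; now apply (is_pseries_plus (V := C_NormedModule)); auto. Qed.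

Lemma has_expansion_scal (c : C) (f : C -> C) (a : nat -> C) :
  has_expansion f a -> has_expansion (fun z => c * f z)%C (fun k => c * a k)%C.
Proof.
intros fa z z1; apply (is_pseries_scal (V := C_NormedModule)); [|now apply fa].
apply Cmult_comm.
Qed.

Lemma has_expansion_poly (b : nat -> C) (N : nat) :
  has_expansion (fun z => sum_n_m (fun k => b k * z ^ k)%C 0 N)
    (fun k => if (k <=? N)%nat then b k else 0%C).
Proof.
intros z _; unfold is_pseries.
set (c := fun k => if (k <=? N)%nat then b k else RtoC 0).
replace (sum_n_m (fun k => b k * z ^ k)%C 0 N) with
  (sum_n (G := C_AbelianMonoid) (fun k => scal (V := C_NormedModule)
    (pow_n (K := C_AbsRing) z k) (c k)) N).
- apply (is_series_finite (V := C_NormedModule)); intros k Nk.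
  unfold c; replace (k <=? N)%nat with false by (symmetry; apply Nat.leb_gt; lia).
  apply (scal_zero_r (V := C_NormedModule)).
- apply sum_n_m_ext_loc; intros k [_ Hk].
  apply Nat.leb_le in Hk; unfold c; rewrite Hk, pow_n_Cpow; apply Cmult_comm.
Qed.

(** * Bounds on the squared norm *)

(** Carries an expansion as witness, so that membership in [H2] and a norm bound are handled
    together and estimates need not go through [hat]. *)
Definition H2_sqnorm_le (f : C -> C) (e : R) : Prop :=
  exists (a : nat -> C) (s : R), has_expansion f a /\
    is_series (fun k => (Cmod (a k) ^ 2)%R) s /\ (s <= e)%R.

Lemma H2_sqnorm_le_in_H2 (f : C -> C) (e : R) : H2_sqnorm_le f e -> in_H2 f.
Proof. intros (a & s & fa & Hs & _); exists a; split; [easy|now exists s]. Qed.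

Lemma in_H2_sqnorm_le (f : C -> C) : in_H2 f -> exists e, H2_sqnorm_le f e.
Proof.
intros (a & fa & s & Hs); exists s, a, s; repeat split; auto; lra.
Qed.

(** Returns from witnessed bounds to [H2_norm]: by [hat_eq] the terms of the inner product are [a k]
    times its conjugate, that is, the squared moduli. *)
Lemma H2_norm_le (f : C -> C) (e : R) :
  (0 <= e)%R -> H2_sqnorm_le f (e ^ 2) -> (H2_norm f <= e)%R.
Proof.
intros e0 (a & s & fa & Hs & se).
change (sqrt (Series (fun k => Re (hat f k * Cconj (hat f k))%C)) <= e)%R.
replace (Series _) with s.
- rewrite <- (sqrt_pow2 e) by lra; now apply sqrt_le_1_alt.
- rewrite <- (is_series_unique _ _ Hs); apply Series_ext; intros k.
  rewrite (hat_eq f a fa), <- Cmod2_conj; reflexivity.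
Qed.

(** From the triangle inequality and [(s + t)^2 = 2 s^2 + 2 t^2 - (s - t)^2]. *)
Lemma Cmod_plus_sqr (x y : C) :
  (Cmod (x + y) ^ 2 <= 2 * Cmod x ^ 2 + 2 * Cmod y ^ 2)%R.
Proof.
assert (H := Cmod_triangle x y); assert (H0 := Cmod_ge_0 (x + y)).
assert (H1 := pow2_ge_0 (Cmod x - Cmod y)).
assert (H2 := pow_incr _ _ 2 (conj H0 H)); nra.
Qed.

(** A weak triangle inequality, obtained by comparing series term by term; the factors 2 are
    absorbed later by smaller tolerances. *)
Lemma H2_sqnorm_le_plus (f g : C -> C) (e e' : R) :
  H2_sqnorm_le f e -> H2_sqnorm_le g e' ->
  H2_sqnorm_le (fun z => f z + g z)%C (2 * e + 2 * e').
Proof.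
intros (a & s & fa & Hs & se) (b & t & gb & Ht & te).
assert (Hst : is_series (fun k => 2 * Cmod (a k) ^ 2 + 2 * Cmod (b k) ^ 2)%R
  (2 * s + 2 * t)%R).
{ apply (is_series_plus (V := R_NormedModule));
    now apply (is_series_scal (V := R_NormedModule)). }
assert (bound : forall k, (0 <= Cmod (a k + b k) ^ 2 <=
  2 * Cmod (a k) ^ 2 + 2 * Cmod (b k) ^ 2)%R).
{ intros k; split; [apply pow2_ge_0|apply Cmod_plus_sqr]. }
exists (fun k => a k + b k)%C, (Series (fun k => Cmod (a k + b k) ^ 2)%R).
split; [now apply has_expansion_plus|split].
- apply Series_correct, (ex_series_le (V := R_CompleteNormedModule)) with
    (2 := ex_intro _ _ Hst).
  intros k; change (Rabs (Cmod (a k + b k) ^ 2) <=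
    2 * Cmod (a k) ^ 2 + 2 * Cmod (b k) ^ 2)%R.
  rewrite Rabs_pos_eq; apply bound.
- apply Rle_trans with (2 * s + 2 * t)%R; [|lra].
  rewrite <- (is_series_unique _ _ Hst).
  apply Series_le; [exact bound|now exists (2 * s + 2 * t)%R].
Qed.

Lemma H2_sqnorm_le_scal (c : C) (f : C -> C) (e : R) :
  H2_sqnorm_le f e ->
  H2_sqnorm_le (fun z => c * f z)%C (Cmod c ^ 2 * e).
Proof.
intros (a & s & fa & Hs & se).
exists (fun k => c * a k)%C, (Cmod c ^ 2 * s)%R.
split; [now apply has_expansion_scal|split].
- apply (is_series_ext (fun k => Cmod c ^ 2 * Cmod (a k) ^ 2)%R).
  + intros k; now rewrite Cmod_mult, Rpow_mult_distr.
  + now apply (is_series_scal (V := R_NormedModule)).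
- assert (Hc := pow2_ge_0 (Cmod c)); nra.
Qed.

Lemma H2_sqnorm_le_ext (f g : C -> C) (e e' : R) :
  (forall z, (Cmod z < 1)%R -> f z = g z) -> (e <= e')%R ->
  H2_sqnorm_le f e -> H2_sqnorm_le g e'.
Proof.
intros fg ee (a & s & fa & Hs & se); exists a, s.
split; [|split; [easy|lra]].
now apply (has_expansion_ext f _ a).
Qed.

Lemma in_H2_plus (f g : C -> C) :
  in_H2 f -> in_H2 g -> in_H2 (fun z => f z + g z)%C.
Proof.
intros Hf Hg.
destruct (in_H2_sqnorm_le f Hf) as [e Hf'].
destruct (in_H2_sqnorm_le g Hg) as [e' Hg'].
now apply (H2_sqnorm_le_in_H2 _ (2 * e + 2 * e')), H2_sqnorm_le_plus.
Qed.

Lemma in_H2_scal (c : C) (f : C -> C) :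
  in_H2 f -> in_H2 (fun z => c * f z)%C.
Proof.
intros Hf; destruct (in_H2_sqnorm_le f Hf) as [e Hf'].
now apply (H2_sqnorm_le_in_H2 _ (Cmod c ^ 2 * e)), H2_sqnorm_le_scal.
Qed.

Lemma in_H2_ext (f g : C -> C) :
  (forall z, (Cmod z < 1)%R -> f z = g z) -> in_H2 f -> in_H2 g.
Proof.
intros fg (a & fa & Hs); exists a; split; [|easy].
now apply (has_expansion_ext f _ a).
Qed.

(** * The vectors [W_n 1] *)

(* For [n >= 1] this is [W_n 1]. *)
Definition geom (n : nat) (z : C) : C := sum_n_m (fun j => z ^ j)%C 0 (n - 1).

Lemma geom_eq (n : nat) (z : C) :
  (1 <= n)%nat -> ((1 - z) * geom n z = 1 - z ^ n)%C.
Proof.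
unfold geom; intros n1; replace n with (S (n - 1)) at 2 by lia.
induction (n - 1)%nat as [|k IH].
- rewrite sum_n_n; simpl; ring.
- rewrite sum_n_Sm by lia.
  change plus with Cplus; rewrite Cmult_plus_distr_l, IH; simpl; ring.
Qed.

Lemma Cmod_lt_1_neq_1 (z : C) : (Cmod z < 1)%R -> (1 - z)%C <> 0%C.
Proof.
intros z1 Hz; assert (z = 1%C) as ->.
{ replace z with (1 - (1 - z))%C by ring; rewrite Hz; ring. }
rewrite Cmod_1 in z1; lra.
Qed.

(** This is [W_n W_q = W_(nq)] applied to 1. Multiplied by [1 - z], which is nonzero on the disk,
    both sides become [1 - z^(nq)]. *)
Lemma geom_mult (n q : nat) (z : C) :
  (1 <= n)%nat -> (1 <= q)%nat -> (Cmod z < 1)%R ->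
  (geom n z * geom q (z ^ n) = geom (n * q) z)%C.
Proof.
intros n1 q1 z1; apply Cmod_lt_1_neq_1 in z1.
assert (key : ((1 - z) * (geom n z * geom q (z ^ n)) =
  (1 - z) * geom (n * q) z)%C).
{ rewrite Cmult_assoc, !geom_eq, Cpow_mult_r by nia; ring. }
rewrite <- (Cmult_1_l (geom n z * _)), <- (Cinv_l (1 - z)) by easy.
rewrite <- Cmult_assoc, key, Cmult_assoc, Cinv_l by easy; apply Cmult_1_l.
Qed.

(** There are [n] coefficients equal to 1 and the rest vanish. The growth of [W_q], as [sqrt q]
    times an isometry, enters the proof in this form. *)
Lemma geom_sqnorm_le (n : nat) :
  (1 <= n)%nat -> H2_sqnorm_le (geom n) (INR n).
Proof.
intros n1.
set (a := fun k => if (k <=? n - 1)%nat then RtoC 1 else RtoC 0).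
exists a, (sum_n (fun k => Cmod (a k) ^ 2)%R (n - 1)).
split; [|split].
- apply has_expansion_ext with (3 := has_expansion_poly (fun _ => RtoC 1) (n - 1)).
  + intros z _; apply sum_n_m_ext; intros k; apply Cmult_1_l.
  + easy.
- apply (is_series_finite (V := R_NormedModule)); intros k Hk; unfold a.
  replace (k <=? n - 1)%nat with false by (symmetry; apply Nat.leb_gt; lia).
  rewrite Cmod_0; apply pow_ne_zero; lia.
- unfold sum_n; rewrite (sum_n_m_ext_loc _ (fun _ => 1%R)).
  + rewrite sum_n_m_const; replace (S (n - 1) - 0)%nat with n by lia.
    lra.
  + intros k [_ Hk]; unfold a; apply Nat.leb_le in Hk; rewrite Hk, Cmod_1.
    apply pow1.
Qed.

Lemma geom_in_H2 (n : nat) : (1 <= n)%nat -> in_H2 (geom n).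
Proof. intros n1; eapply H2_sqnorm_le_in_H2, geom_sqnorm_le, n1. Qed.

(** * The span of the [W_n f] *)

Lemma W_span_plus (f g h : C -> C) :
  W_span f g -> W_span f h -> W_span f (fun z => g z + h z)%C.
Proof.
(* Zero coefficients bring two combinations to a common length. *)
assert (pad : forall N M (c : nat -> C) z, (N <= M)%nat ->
  sum_n_m (fun n => (if (n <=? N)%nat then c n else 0) * W n f z)%C 1 M =
  sum_n_m (fun n => c n * W n f z)%C 1 N).
{ intros N M c z NM.
  rewrite (sum_n_m_Chasles _ 1 N M) by lia.
  rewrite (sum_n_m_ext_loc _ (fun _ => zero) (S N) M).
  - rewrite sum_n_m_const_zero, plus_zero_r; apply sum_n_m_ext_loc.
    intros k [_ Hk]; apply Nat.leb_le in Hk; now rewrite Hk.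
  - intros k Hk.
    replace (k <=? N)%nat with false by (symmetry; apply Nat.leb_gt; lia).
    apply Cmult_0_l. }
intros (N & c & gc) (M & d & hd).
exists (max N M), (fun n => (if (n <=? N)%nat then c n else 0) +
  (if (n <=? M)%nat then d n else 0))%C; intros z z1.
rewrite gc, hd, <- (pad N (max N M)), <- (pad M (max N M)) by (easy || lia).
change Cplus with (plus (G := C_AbelianMonoid)); rewrite <- sum_n_m_plus.
apply sum_n_m_ext; intros k; symmetry; apply Cmult_plus_distr_r.
Qed.

Lemma W_span_scal (f g : C -> C) (c : C) :
  W_span f g -> W_span f (fun z => c * g z)%C.
Proof.
intros (N & d & gd); exists N, (fun n => c * d n)%C; intros z z1.
rewrite gd by easy.
transitivity (sum_n_m (fun n => c * (d n * W n f z))%C 1 N).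
{ symmetry; apply (sum_n_m_mult_l (K := C_Ring)). }
apply sum_n_m_ext; intros k; apply Cmult_assoc.
Qed.

Lemma W_span_ext (f g h : C -> C) :
  (forall z, (Cmod z < 1)%R -> g z = h z) -> W_span f g -> W_span f h.
Proof.
intros gh (N & c & gc); exists N, c; intros z z1; now rewrite <- gh, gc.
Qed.

Lemma W_span_0 (f : C -> C) : W_span f (fun _ => 0%C).
Proof. exists 0%nat, (fun _ => 0%C); intros z _; now rewrite sum_n_m_zero by lia. Qed.

Lemma W_span_W (f : C -> C) (n : nat) : (1 <= n)%nat -> W_span f (W n f).
Proof.
intros n1; exists n, (fun k => if (k =? n)%nat then 1%C else 0%C); intros z _.
rewrite (sum_n_m_Chasles _ 1 (n - 1) n) by lia.
replace (S (n - 1)) with n by lia.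
rewrite sum_n_n, Nat.eqb_refl, (sum_n_m_ext_loc _ (fun _ => zero)).
- rewrite sum_n_m_const_zero, plus_zero_l; symmetry; apply Cmult_1_l.
- intros k Hk.
  replace (k =? n)%nat with false by (symmetry; apply Nat.eqb_neq; lia).
  apply Cmult_0_l.
Qed.

Lemma W_span_in_H2 (f h : C -> C) :
  (forall n, (1 <= n)%nat -> in_H2 (W n f)) -> W_span f h -> in_H2 h.
Proof.
intros Wf (N & c & hc).
apply (in_H2_ext (fun z => sum_n_m (fun n => c n * W n f z)%C 1 N)).
{ intros z z1; symmetry; now apply hc. }
clear hc; induction N as [|N IH].
(* The empty sum is presented as a multiple of a vector known to lie in [H2]. *)
- apply (in_H2_ext (fun z => 0 * geom 1 z)%C).
  + intros z _; rewrite sum_n_m_zero by lia; apply Cmult_0_l.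
  + now apply in_H2_scal, geom_in_H2.
- apply (in_H2_ext
    (fun z => sum_n_m (fun n => c n * W n f z) 1 N + c (S N) * W (S N) f z)%C).
  + intros z _; rewrite sum_n_Sm by lia; easy.
  + apply in_H2_plus; [easy|apply in_H2_scal, Wf; lia].
Qed.

(** * The closed span *)

(** The error is measured by the squared norm, to match [H2_sqnorm_le]. *)
Definition W_closure (f g : C -> C) : Prop :=
  forall e : R, (0 < e)%R ->
    exists h, W_span f h /\ H2_sqnorm_le (fun z => g z - h z)%C e.

Lemma W_closure_plus (f g h : C -> C) :
  W_closure f g -> W_closure f h -> W_closure f (fun z => g z + h z)%C.
Proof.
intros Hg Hh e e0.
(* Addition doubles both errors: [2 (e / 4) + 2 (e / 4) = e]. *)
destruct (Hg (e / 4)%R) as (g' & Sg & Lg); [lra|].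
destruct (Hh (e / 4)%R) as (h' & Sh & Lh); [lra|].
exists (fun z => g' z + h' z)%C; split; [now apply W_span_plus|].
eapply H2_sqnorm_le_ext, (H2_sqnorm_le_plus _ _ _ _ Lg Lh); [|lra].
intros z _; simpl; ring.
Qed.

Lemma W_closure_scal (f g : C -> C) (c : C) :
  W_closure f g -> W_closure f (fun z => c * g z)%C.
Proof.
intros Hg e e0; assert (c0 := pow2_ge_0 (Cmod c)).
(* The added 1 keeps the denominator positive when [c = 0]. *)
destruct (Hg (e / (Cmod c ^ 2 + 1))%R) as (g' & Sg & Lg).
{ apply Rdiv_lt_0_compat; lra. }
exists (fun z => c * g' z)%C; split; [now apply W_span_scal|].
eapply H2_sqnorm_le_ext, (H2_sqnorm_le_scal c _ _ Lg).
- intros z _; simpl; ring.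
- apply Rmult_le_reg_r with (Cmod c ^ 2 + 1)%R; [lra|].
  field_simplify; nra.
Qed.

Lemma W_closure_ext (f g h : C -> C) :
  (forall z, (Cmod z < 1)%R -> g z = h z) -> W_closure f g -> W_closure f h.
Proof.
intros gh Hg e e0; destruct (Hg e e0) as (g' & Sg & Lg).
exists g'; split; [easy|].
eapply H2_sqnorm_le_ext, Lg; [|lra].
intros z z1; simpl; now rewrite gh.
Qed.

(** Consecutive differences of the [geom n] are monomials: [z^(N+1) = geom (N+2) z - geom (N+1) z],
    and [geom 1] is the constant 1. *)
Lemma W_closure_poly (f : C -> C) (b : nat -> C) (N : nat) :
  (forall n, (1 <= n)%nat -> W_closure f (geom n)) ->
  W_closure f (fun z => sum_n_m (fun k => b k * z ^ k)%C 0 N).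
Proof.
intros Hf; induction N as [|N IH].
- apply (W_closure_ext _ (fun z => b 0%nat * geom 1 z)%C).
  + intros z _; unfold geom; now rewrite !sum_n_n.
  + now apply W_closure_scal, Hf.
- apply (W_closure_ext _ (fun z => sum_n_m (fun k => b k * z ^ k) 0 N +
    b (S N) * (geom (S (S N)) z + (-1) * geom (S N) z))%C).
  + intros z _; rewrite (sum_n_Sm _ 0 N) by lia.
    unfold geom; replace (S (S N) - 1)%nat with (S N) by lia.
    replace (S N - 1)%nat with N by lia; rewrite (sum_n_Sm _ 0 N) by lia.
    change plus with Cplus; ring.
  + apply W_closure_plus; [easy|].
    apply W_closure_scal, W_closure_plus; [apply Hf; lia|].
    apply W_closure_scal, Hf; lia.
Qed.

(** * Density of polynomials and a criterion for cyclicity *)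

(** The Taylor polynomials of [g] serve: the squared norm of the tail is the full sum minus a
    partial sum. *)
Lemma H2_truncation (g : C -> C) (e : R) :
  in_H2 g -> (0 < e)%R -> exists (b : nat -> C) (N : nat),
    H2_sqnorm_le (fun z => g z - sum_n_m (fun k => b k * z ^ k) 0 N)%C e.
Proof.
intros (a & ga & s & Hs) e0.
destruct (Hs (fun y => (s - e < y)%R)) as [N HN].
{ exists (mkposreal e e0); intros y Hy; apply Rabs_lt_between' in Hy.
  simpl in Hy; lra. }
assert (HN' : (s - e < sum_n (fun k => Cmod (a k) ^ 2)%R N)%R)
  by exact (HN N (le_n N)).
exists a, N, (fun k => a k + (-1) * (if (k <=? N)%nat then a k else 0))%C.
exists (s - sum_n (fun k => Cmod (a k) ^ 2)%R N)%R.
split; [|split; [|lra]].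
- apply (has_expansion_ext
    (fun z => g z + (-1) * sum_n_m (fun k => a k * z ^ k) 0 N)%C
    (fun z => g z - sum_n_m (fun k => a k * z ^ k) 0 N)%C
    (fun k => a k + (-1) * (if (k <=? N)%nat then a k else 0))%C).
  + intros z _; ring.
  + easy.
  + apply has_expansion_plus, has_expansion_scal, has_expansion_poly; easy.
(* The squared moduli of the tail are those of [g] minus the finitely supported [head]. *)
- set (head := fun k => if (k <=? N)%nat then (Cmod (a k) ^ 2)%R else 0%R).
  apply (is_series_ext (fun k => Cmod (a k) ^ 2 - head k)%R).
  + intros k; unfold head; destruct (k <=? N)%nat.
    * replace (a k + (-1) * a k)%C with (RtoC 0) by ring.
      rewrite Cmod_0; simpl; ring.
    * replace (a k + (-1) * 0)%C with (a k) by ring; simpl; ring.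
  + apply (is_series_minus (V := R_NormedModule)); [easy|].
    rewrite (sum_n_ext_loc _ head).
    * apply (is_series_finite (V := R_NormedModule)); intros k Hk; unfold head.
      now replace (k <=? N)%nat with false
        by (symmetry; apply Nat.leb_gt; lia).
    * intros k Hk; apply Nat.leb_le in Hk; unfold head; now rewrite Hk.
Qed.

(** A vector of [H2] is approximated by a polynomial, and that polynomial by an element of the
    span. *)
Lemma W_cyclic_of_geom (f : C -> C) :
  (forall n, (1 <= n)%nat -> in_H2 (W n f)) -> in_H2 f ->
  (forall n, (1 <= n)%nat -> W_closure f (geom n)) -> W_cyclic f.
Proof.
intros Wf Hf Hgeom; split; [easy|]; intros g e Hg e0.
(* Two squared errors of [e^2 / 16] combine to [e^2 / 4], so the norm is at most [e / 2], strictly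
   below [e]. *)
assert (e2 : (0 < e ^ 2 / 16)%R).
{ apply Rdiv_lt_0_compat; [now apply pow_lt|lra]. }
destruct (H2_truncation g (e ^ 2 / 16) Hg e2) as (b & N & Hb).
destruct (W_closure_poly f b N Hgeom (e ^ 2 / 16) e2) as (h & Sh & Lh).
exists h; split; [easy|split; [now apply (W_span_in_H2 f)|]].
apply Rle_lt_trans with (e / 2)%R; [|lra].
apply H2_norm_le; [lra|].
eapply H2_sqnorm_le_ext, (H2_sqnorm_le_plus _ _ _ _ Hb Lh); [|lra].
intros z _; simpl; ring.
Qed.

(** * The vectors [W_n p] and the Neumann series *)

Lemma p_geom (m : nat) (lambda z : C) :
  (1 <= m)%nat -> p m lambda z = (geom (m + 1) z - (lambda + 1))%C.
Proof.
intros m1; unfold p, geom; replace (m + 1 - 1)%nat with m by lia.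
rewrite (sum_Sn_m _ 0 m) by lia.
change plus with Cplus; simpl; ring.
Qed.

(** Applies [W_n] to [p = (W_q - (lambda + 1)) 1] with [q = m + 1], using [W_n W_q = W_(nq)]. *)
Lemma W_p (m n : nat) (lambda z : C) :
  (1 <= m)%nat -> (1 <= n)%nat -> (Cmod z < 1)%R ->
  W n (p m lambda) z = (geom (n * (m + 1)) z - (lambda + 1) * geom n z)%C.
Proof.
intros m1 n1 z1; rewrite <- geom_mult by (easy || lia).
unfold W; fold (geom n z); rewrite p_geom by easy; ring.
Qed.

Lemma W_p_in_H2 (m n : nat) (lambda : C) :
  (1 <= m)%nat -> (1 <= n)%nat -> in_H2 (W n (p m lambda)).
Proof.
intros m1 n1.
apply (in_H2_ext
  (fun z => geom (n * (m + 1)) z + (- (lambda + 1)) * geom n z)%C).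
- intros z z1; rewrite W_p by easy; ring.
- apply in_H2_plus; [|apply in_H2_scal]; apply geom_in_H2; nia.
Qed.

Lemma p_in_H2 (m : nat) (lambda : C) : (1 <= m)%nat -> in_H2 (p m lambda).
Proof.
(* [W_1] is the identity. *)
intros m1; apply (in_H2_ext (W 1 (p m lambda))); [|now apply W_p_in_H2].
intros z z1; rewrite W_p, Nat.mul_1_l, p_geom by easy.
unfold geom at 2; rewrite sum_n_n; simpl; ring.
Qed.

(* Partial sums of the Neumann series for [(W_(m+1) - (lambda + 1))^-1]
   applied to [W_n 1]. *)
Lemma W_span_geom_remainder (m n K : nat) (lambda : C) :
  (1 <= m)%nat -> (1 <= n)%nat -> (lambda + 1)%C <> 0%C ->
  W_span (p m lambda) (fun z =>
    geom n z - (/ (lambda + 1)) ^ K * geom (n * (m + 1) ^ K) z)%C.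
Proof.
intros m1 n1 l0; induction K as [|K IH].
- eapply W_span_ext, W_span_0; intros z _; simpl.
  rewrite Nat.mul_1_r; ring.
- assert (nK : (1 <= n * (m + 1) ^ K)%nat).
  { assert ((m + 1) ^ K <> 0)%nat by (apply Nat.pow_nonzero; lia); nia. }
  (* With [q = m + 1] and [c = lambda + 1], the added term [- c^(-K-1) W_(n q^K) p] cancels the old
     remainder [c^(-K) geom (n q^K)] and leaves the next one. *)
  eapply W_span_ext, (W_span_plus _ _ _ IH (W_span_scal _ _
    (- (/ (lambda + 1)) ^ S K)%C (W_span_W _ _ nK))).
  intros z z1; simpl; rewrite W_p by easy.
  replace (n * (m + 1) ^ K * (m + 1))%nat with
    (n * ((m + 1) * (m + 1) ^ K))%nat by ring.
  simpl; field; easy.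
Qed.

(** With [q = m + 1], the remainder after [K] steps has squared norm at most [n (q / mu^2)^K], which
    tends to 0 because [mu > sqrt q]. *)
Lemma W_closure_geom (m n : nat) (lambda : C) :
  (1 <= m)%nat -> (1 <= n)%nat -> (Cmod (lambda + 1) > sqrt (INR m + 1))%R ->
  W_closure (p m lambda) (geom n).
Proof.
intros m1 n1 hl e e0.
set (mu := Cmod (lambda + 1)) in *.
assert (m0 := pos_INR m).
assert (q0 := sqrt_lt_R0 (INR m + 1) ltac:(lra)).
assert (l0 : (lambda + 1)%C <> 0%C) by (apply Cmod_gt_0; fold mu; lra).
assert (mu2 : (INR m + 1 < mu ^ 2)%R).
{ rewrite <- (pow2_sqrt (INR m + 1)) by lra; simpl; nra. }
assert (r01 : Rabs ((INR m + 1) / mu ^ 2) < 1).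
{ rewrite Rabs_pos_eq; [|apply Rdiv_le_0_compat; lra].
  apply Rlt_div_l; lra. }
assert (n0 : (0 < INR n)%R) by (apply lt_0_INR; lia).
(* [K] is chosen so that [(q / mu^2)^K < e / n]. *)
destruct (pow_lt_1_zero _ r01 (e / INR n)) as [K HK].
{ now apply Rdiv_lt_0_compat. }
specialize (HK K (le_n K)).
apply (Rle_lt_trans _ _ _ (Rle_abs _)) in HK.
exists (fun z => geom n z - (/ (lambda + 1)) ^ K * geom (n * (m + 1) ^ K) z)%C.
split; [now apply W_span_geom_remainder|].
eapply H2_sqnorm_le_ext, (H2_sqnorm_le_scal ((/ (lambda + 1)) ^ K)%C),
  (geom_sqnorm_le (n * (m + 1) ^ K)).
(* Subtracting the approximant from [geom n] leaves exactly the remainder. *)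
- intros z _; simpl; ring.
- rewrite Cmod_pow, Cmod_inv, mult_INR, pow_INR, plus_INR by easy; fold mu.
  simpl INR.
  apply Rle_trans with (INR n * ((INR m + 1) / mu ^ 2) ^ K)%R.
  + right; unfold Rdiv; rewrite Rpow_mult_distr.
    replace ((/ mu ^ 2) ^ K)%R with (((/ mu) ^ K) ^ 2)%R; [ring|].
    rewrite <- pow_inv, <- !pow_mult; f_equal; lia.
  + apply Rlt_div_r in HK; lra.
- assert ((m + 1) ^ K <> 0)%nat by (apply Nat.pow_nonzero; lia); nia.
Qed.

Theorem theorem13 (m : nat) (lambda : C) (hm : (1 <= m)%nat)
  (hlambda : (Cmod (lambda + 1)%C > sqrt (INR m + 1))%R) :
  W_cyclic (p m lambda).
Proof.
apply W_cyclic_of_geom.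
- intros n n1; now apply W_p_in_H2.
- now apply p_in_H2.
- intros n n1; now apply W_closure_geom.
Qed.
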